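(* Let $G$ be a graph of order $n$ and size $m$ with $m \ge 2n-1$, and let $L(G)$ be its line graph. Then \[ n^+(L(G)) \le n^-(L(G)) + 1. \]
   Context: Graphs are finite and simple. The order of a graph is its number of vertices and its size is its number of edges. For a graph $H$ with adjacency matrix $A(H)$, $n^+(H)$ and $n^-(H)$ denote the number of positive and negative eigenvalues of $A(H)$, respectively, counted with multiplicity. The line graph $L(G)$ has the edges of $G$ as vertices, two distinct edges being adjacent when they share an endpoint. *)

(* Defs.v *)
From mathcomp Require Import all_boot all_order all_algebra.

Set Implicit Arguments.
Unset Strict Implicit.
Unset Printing Implicit Defensive.

Import Order.TTheory GRing.Theory Num.Theory.
Local Open Scope ring_scope.

Record sgraph := SGraph {
  vertex :> finType;
  adj : rel vertex;
  adj_sym : symmetric adj;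
  adj_irrefl : irreflexive adj
}.

Definition graph_order (G : sgraph) : nat := #|G|.

(* Edges are unordered pairs, represented as two-element vertex sets. *)
Definition edges (G : sgraph) : {set {set G}} :=
  [set [set p.1; p.2] | p : G * G & adj p.1 p.2].

Definition graph_size (G : sgraph) : nat := #|edges G|.

Section LineGraph.

Variable G : sgraph.

Definition edge_type : finType := {e : {set G} | e \in edges G}.

Definition line_adj : rel edge_type :=
  fun e f => (e != f) && (val e :&: val f != set0).

Lemma line_adj_sym : symmetric line_adj.
Proof. by move=> e f; rewrite /line_adj eq_sym setIC. Qed.

Lemma line_adj_irrefl : irreflexive line_adj.
Proof. by move=> e; rewrite /line_adj eqxx. Qed.

Definition line_graph : sgraph := SGraph line_adj_sym line_adj_irrefl.

End LineGraph.

Definition adjmx (R : pzRingType) (H : sgraph) : 'M[R]_#|H| :=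
  \matrix_(i, j) (adj (enum_val i) (enum_val j))%:R.

(* The eigenvalues listed with multiplicity: a list s such that the monic
   polynomial char_poly A is the product of the 'X - z%:P for z in s; it is
   unique up to permutation. *)
Definition eigenvalues (C : numClosedFieldType) (n : nat) (A : 'M[C]_n) :
    seq C :=
  sval (closed_field_poly_normal (char_poly A)).

Lemma char_poly_eigenvalues (C : numClosedFieldType) (n : nat) (A : 'M[C]_n) :
  char_poly A = \prod_(z <- eigenvalues A) ('X - z%:P).
Proof.
rewrite /eigenvalues; case: closed_field_poly_normal => s /= {1}->.
by rewrite (monicP (char_poly_monic A)) scale1r.
Qed.

(* In a numClosedFieldType, 0 < z (resp. z < 0) entails that z is real. *)
Definition npos_eig (C : numClosedFieldType) (H : sgraph) : nat :=
  count (fun z : C => 0 < z) (eigenvalues (adjmx C H)).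

Definition nneg_eig (C : numClosedFieldType) (H : sgraph) : nat :=
  count (fun z : C => z < 0) (eigenvalues (adjmx C H)).

(* Main.v *)
Require Import Defs.
From mathcomp Require Import all_boot all_order all_algebra.
From mathcomp Require Import zify.

(** If [B] is the [n x m] vertex-edge incidence matrix of [G], the adjacency
    matrix of [L(G)] is [B^T B - 2 I].  The characteristic polynomials of
    [B^T B] and [B B^T] differ by the factor [X^(m - n)], so [-2] is an
    eigenvalue of [L(G)] of multiplicity at least [m - n >= n - 1].  Hence
    [n^- >= m - n >= n - 1], and [n^+ <= n] because [n^+ + n^- <= m]. *)

Set Implicit Arguments.
Unset Strict Implicit.
Unset Printing Implicit Defensive.

Import Order.TTheory GRing.Theory Num.Theory.
Local Open Scope ring_scope.

(** Sylvester's identity, without division: [M] is multiplied on the right by two block triangular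
    matrices, the first clearing its block [Q], the second its block [P], and determinants are
    compared. *)
Lemma det_scalar_sub_mulmxC (R : comNzRingType) m n (x : R)
    (P : 'M_(m, n)) (Q : 'M_(n, m)) :
  \det (x%:M - P *m Q) * x ^+ n = \det (x%:M - Q *m P) * x ^+ m.
Proof.
pose M := block_mx 1%:M Q P x%:M.
have detM : \det M = \det (x%:M - P *m Q).
  have : M *m block_mx 1%:M (- Q) 0 1%:M = block_mx 1%:M 0 P (x%:M - P *m Q).
    rewrite mulmx_block !mulmx1 !mulmx0 !mul1mx !addr0 mulmxN.
    by rewrite addNr (addrC (- _)).
  move/(congr1 determinant).
  by rewrite det_mulmx det_ublock det_lblock !det1 !mul1r mulr1.
have : M *m block_mx x%:M 0 (- P) 1%:M = block_mx (x%:M - Q *m P) Q 0 x%:M.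
  rewrite mulmx_block !mulmx1 !mulmx0 !mul1mx !add0r !mulmxN.
  by rewrite mul_mx_scalar mul_scalar_mx subrr.
move/(congr1 determinant).
by rewrite det_mulmx detM det_ublock det_lblock det1 mulr1 !det_scalar.
Qed.

(** Taking ['X - c%:P] for [x] in the determinant identity shows that its [m]-th power divides
    [char_poly A * ('X - c%:P) ^+ n]; the multiplicity of the root [c] is then read off. *)
Lemma count_eigenvalues_ge (C : numClosedFieldType) m n (c : C)
    (P : 'M_(m, n)) (Q : 'M_(n, m)) :
  (m <= count_mem c (eigenvalues (P *m Q + c%:M)) + n)%N.
Proof.
set A := _ + _.
have charA : char_poly_mx A =
    ('X - c%:P)%:M - map_mx polyC P *m map_mx polyC Q.
  rewrite /char_poly_mx /A map_mxD map_mxM map_scalar_mx /=.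
  by rewrite raddfB /= opprD addrA addrAC.
have Xc0 k : ('X - c%:P) ^+ k != 0 by rewrite expf_neq0 // polyXsubC_eq0.
have char0 : char_poly A != 0 by rewrite monic_neq0 // char_poly_monic.
have -> : (count_mem c (eigenvalues A) + n)%N =
    mup c (char_poly A * ('X - c%:P) ^+ n).
  by rewrite mupM // mup_XsubCX eqxx char_poly_eigenvalues mu_prod_XsubC.
rewrite mup_geq ?mulf_neq0 // {1}/char_poly charA det_scalar_sub_mulmxC.
exact: dvdp_mulIr.
Qed.

Lemma size_eigenvalues (C : numClosedFieldType) n (A : 'M[C]_n) :
  size (eigenvalues A) = n.
Proof.
have := size_char_poly A.
by rewrite char_poly_eigenvalues size_prod_XsubC => -[].
Qed.

Definition incidencemx (R : pzRingType) (G : sgraph) :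
    'M[R]_(#|G|, #|edge_type G|) :=
  \matrix_(i, j)
    ((enum_val i : G) \in val (enum_val j : edge_type G))%:R.

Lemma card_edge (G : sgraph) (e : {set G}) : e \in edges G -> #|e| = 2%N.
Proof.
case/imsetP=> -[x y] /=; rewrite inE /= => adj_xy ->.
rewrite cards2; case: eqVneq => // eq_xy.
by rewrite eq_xy adj_irrefl in adj_xy.
Qed.

Lemma card_edgeI (G : sgraph) (e f : edge_type G) :
  #|val e :&: val f| = ((e == f).*2 + line_adj e f)%N.
Proof.
rewrite /line_adj; case: eqVneq => [->|neq_ef] /=.
  by rewrite setIid (card_edge (valP f)).
rewrite -cards_eq0 -lt0n add0n.
suff : (#|val e :&: val f| < 2)%N by case: #|_| => [|[]].
rewrite ltn_neqAle -{2}(card_edge (valP e)) subset_leq_card ?subsetIl // andbT.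
apply: contra neq_ef => /eqP cardI; apply/eqP/val_inj.
(* An intersection with two elements would fill both edges and make them equal. *)
have eqI g : g \in edges G -> val e :&: val f \subset g -> val e :&: val f = g.
  by move=> Eg sub; apply/eqP; rewrite eqEcard sub cardI card_edge.
by rewrite -(eqI _ (valP e) (subsetIl _ _)) {1}(eqI _ (valP f) (subsetIr _ _)).
Qed.

(** Entries of the Gram matrix count common endpoints: 2 on the diagonal, which the shift by -2
    cancels, and 0 or 1 elsewhere. *)
Lemma adjmx_line_graph (R : pzRingType) (G : sgraph) :
  adjmx R (line_graph G) = (incidencemx R G)^T *m incidencemx R G + (- 2)%:M.
Proof.
apply/matrixP=> i j; rewrite !mxE.
have -> : \sum_k (incidencemx R G)^T i k * incidencemx R G k j =
    #|val (enum_val i) :&: val (enum_val j)|%:R.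
  rewrite -sum1_card natr_sum (reindex (@enum_val _ G)) /=; last first.
    exact/onW_bij/enum_val_bij.
  rewrite [RHS]big_mkcond; apply: eq_bigr => k _; rewrite !mxE inE -natrM mulnb.
  by case: (_ && _).
rewrite card_edgeI (inj_eq enum_val_inj) natrD addrAC.
by case: (i == j); rewrite ?subrr ?addr0 ?add0r //= mulr1n subrr add0r.
Qed.

Theorem mainTheorem4 (C : numClosedFieldType) (G : sgraph)
    (hm : (2 * graph_order G - 1 <= graph_size G)%N) :
  (npos_eig C (line_graph G) <= nneg_eig C (line_graph G) + 1)%N.
Proof.
rewrite /npos_eig /nneg_eig; set s := eigenvalues _.
have size_s : size s = graph_size G.
  by rewrite size_eigenvalues card_sig; apply: eq_card => e.
have mult_le :
    (graph_size G <= count (fun z : C => z < 0)%R s + graph_order G)%N.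
  have := count_eigenvalues_ge (- 2) (incidencemx C G)^T (incidencemx C G).
  rewrite -adjmx_line_graph -size_s size_eigenvalues => /leq_trans; apply.
  apply: leq_add => //; apply: sub_count => z /eqP->.
  by rewrite oppr_lt0 ltr0n.
have signs_le : (count (fun z : C => 0 < z)%R s + count (fun z : C => z < 0)%R s
    <= graph_size G)%N.
  (* The two counts add up to those of the union and the intersection of the predicates, and the
     intersection is empty. *)
  rewrite -size_s -count_predUI addnC -[leqRHS]add0n leq_add ?count_size //.
  rewrite leqNgt -has_count; apply/hasPn=> z _ /=.
  by apply/negP=> /andP[z_gt0 /(lt_trans z_gt0)]; rewrite ltxx.
(* Together [signs_le] and [mult_le] bound the positive count by the order. If the order is 0, where
   the subtraction in [hm] truncates, this count is already 0. *)
lia.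
Qed.
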